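(* Let $R$ be a valuation domain of cardinality $\aleph_1$ and $J/A$ a type with $J=\bigcup_{\nu<\omega_1} r_\nu^{-1}R$ as in the context. If $\Gamma'_R(J/A)\neq 0$, then there is a non-standard uniserial $R$-module of type $J/A$.
   Context: $R$ is a valuation domain with quotient field $Q\neq R$ and unit group $R^*$. Uniserial: submodules totally ordered. For $R$-submodules $A\subseteq J$ of $Q$, $J/A$ is uniserial; a uniserial module is standard if isomorphic to such a $J/A$, non-standard otherwise. For uniserial $U$ and $0\ne a\in U$, $\mathrm{Ann}(a)=\{r:ra=0\}$, $D(a)=\bigcup\{r^{-1}R: r\text{ divides }a\}$; $U$ has type $J/A$ if $J/A\cong D(a)/\mathrm{Ann}(a)$. Here $J=\bigcup_{\nu<\omega_1}r_\nu^{-1}R$, $r_\nu\ne0$, $r_\mu\mid r_\nu$ for $\mu<\nu$. For a limit $\delta<\omega_1$ let $\mathcal T^\delta_{J/A}=\{\langle u_\sigma:\sigma<\delta\rangle: u_\sigma\in R^*,\ u_\tau-u_\sigma\in r_\sigma A \text{ for all }\sigma<\tau<\delta\}$. An $\omega_1$-filtration of $R$ by subrings is an increasing chain $\{N_\alpha:\alpha<\omega_1\}$ of countable subrings with $R=\bigcup_\alpha N_\alpha$, $N_\alpha=\bigcup_{\beta<\alpha}N_\beta$ for limit $\alpha$, $R^*\cap N_\alpha$ equal to the unit group of $N_\alpha$, and $r_\nu\in N_\alpha\iff\nu<\alpha$. Fixing such a filtration, let $E'=\{\delta<\omega_1\text{ limit}: \exists\langle u_\sigma:\sigma<\delta\rangle\in\mathcal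 T^\delta_{J/A}\ \forall f\in R^*\ \exists\sigma<\delta\ \ u_\sigma f\notin N_\delta+r_\sigma A\}$. Subsets of $\omega_1$ are equivalent if they agree on a closed unbounded set; $\tilde E$ denotes the class of $E$, and $0$ the class of sets disjoint from a cub. $\Gamma'_R(J/A)=\tilde{E'}$ (independent of the choices of $r_\nu$ and filtration). *)

(* Defs.v *)
From mathcomp Require Import all_boot all_order all_algebra fraction.
Set Implicit Arguments. Unset Strict Implicit. Unset Printing Implicit Defensive.
Import GRing.Theory.
Local Open Scope ring_scope.

Definition is_omega1 (W : Type) (lt : W -> W -> Prop) : Prop :=
  [/\ (forall x, ~ lt x x) /\
      (forall x y z, lt x y -> lt y z -> lt x z),
      (forall x y, lt x y \/ x = y \/ lt y x),
      well_founded lt,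
      ~ (exists f : W -> nat, forall x y, f x = f y -> x = y) &
      (forall w, exists f : {v : W | lt v w} -> nat,
          forall x y, f x = f y -> x = y)].

Definition is_limit (W : Type) (lt : W -> W -> Prop) (d : W) : Prop :=
  (exists s, lt s d) /\ (forall s, lt s d -> exists t, lt s t /\ lt t d).

Definition is_cub (W : Type) (lt : W -> W -> Prop) (C : W -> Prop) : Prop :=
  (forall a, exists b, C b /\ lt a b) /\
  (forall d, is_limit lt d ->
     (forall s, lt s d -> exists g, C g /\ lt s g /\ lt g d) -> C d).

(* the class of E in the quotient by "agree on a cub" is nonzero, i.e. E is not
   disjoint from any cub *)
Definition class_nonzero (W : Type) (lt : W -> W -> Prop) (E : W -> Prop) : Prop :=
  ~ (exists C, is_cub lt C /\ forall x, C x -> ~ E x).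

Definition divides (R : idomainType) (a b : R) : Prop := exists c, b = c * a.

Definition valuation_domain (R : idomainType) : Prop :=
  forall a b : R, divides a b \/ divides b a.

Notation "x %:F" := (@FracField.tofrac _ x).

Definition not_field_of_fractions (R : idomainType) : Prop :=
  ~ (forall x : {fraction R}, exists r : R, x = r%:F).

Definition submodQ (R : idomainType) (S : {fraction R} -> Prop) : Prop :=
  [/\ S 0, (forall x y, S x -> S y -> S (x + y)) &
      (forall (c : R) x, S x -> S (c%:F * x))].

Definition Jset (R : idomainType) (W : Type) (r : W -> R) : {fraction R} -> Prop :=
  fun x => exists nu (s : R), x = s%:F / (r nu)%:F.

Definition submodule (R : idomainType) (M : lmodType R) (P : M -> Prop) : Prop :=
  [/\ P 0, (forall x y, P x -> P y -> P (x + y)) &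
      (forall (c : R) x, P x -> P (c *: x))].

Definition uniserial (R : idomainType) (M : lmodType R) : Prop :=
  forall P Q : M -> Prop, submodule P -> submodule Q ->
    (forall x, P x -> Q x) \/ (forall x, Q x -> P x).

Definition iso_to_subquot (R : idomainType) (M : lmodType R)
    (J' A' : {fraction R} -> Prop) : Prop :=
  exists f : {fraction R} -> M,
    [/\ (forall x y, J' x -> J' y -> f (x + y) = f x + f y),
        (forall (c : R) x, J' x -> f (c%:F * x) = c *: f x),
        (forall m, exists x, J' x /\ f x = m) &
        (forall x, J' x -> (f x = 0 <-> A' x))].

Definition standard (R : idomainType) (M : lmodType R) : Prop :=
  exists J' A' : {fraction R} -> Prop,
    [/\ submodQ J', submodQ A', (forall x, A' x -> J' x) & iso_to_subquot M J' A'].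

Definition subquot_iso (R : idomainType) (J1 A1 J2 A2 : {fraction R} -> Prop) : Prop :=
  exists g : {fraction R} -> {fraction R},
    [/\ (forall x y, J1 x -> J1 y -> g (x + y) = g x + g y),
        (forall (c : R) x, J1 x -> g (c%:F * x) = c%:F * g x),
        (forall x, J1 x -> J2 (g x)),
        (forall y, J2 y -> exists x, J1 x /\ A2 (g x - y)) &
        (forall x, J1 x -> (A2 (g x) <-> A1 x))].

Definition Ann_set (R : idomainType) (M : lmodType R) (a : M) : {fraction R} -> Prop :=
  fun x => exists c : R, c *: a = 0 /\ x = c%:F.

Definition D_set (R : idomainType) (M : lmodType R) (a : M) : {fraction R} -> Prop :=
  fun x => exists c : R, [/\ c != 0, (exists u : M, a = c *: u) &
                               exists s : R, x = s%:F / c%:F].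

Definition has_type (R : idomainType) (M : lmodType R) (J A : {fraction R} -> Prop) : Prop :=
  exists a : M, a != 0 /\ subquot_iso J A (D_set a) (Ann_set a).

Definition countable_pred (T : Type) (P : T -> Prop) : Prop :=
  exists f : {x : T | P x} -> nat, forall x y, f x = f y -> x = y.

Definition filtration (R : idomainType) (W : Type) (lt : W -> W -> Prop)
    (r : W -> R) (N : W -> R -> Prop) : Prop :=
  [/\ (forall a, countable_pred (N a)) /\
      (forall a, [/\ N a 0, N a 1, (forall x y, N a x -> N a y -> N a (x - y)) &
                     (forall x y, N a x -> N a y -> N a (x * y))]),
      (forall a b, lt a b -> forall x, N a x -> N b x) /\
      (forall x, exists a, N a x),
      (forall a, is_limit lt a -> forall x, N a x <-> exists b, lt b a /\ N b x),
      (forall a x, N a x -> (x \is a GRing.unit <-> exists y, N a y /\ x * y = 1)) &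
      (forall nu a, N a (r nu) <-> lt nu a)].

Definition T_delta (R : idomainType) (W : Type) (lt : W -> W -> Prop) (r : W -> R)
    (A : {fraction R} -> Prop) (d : W) (u : W -> R) : Prop :=
  (forall s, lt s d -> u s \is a GRing.unit) /\
  (forall s t, lt s t -> lt t d ->
     exists x, A x /\ (u t - u s)%:F = (r s)%:F * x).

Definition E'_set (R : idomainType) (W : Type) (lt : W -> W -> Prop) (r : W -> R)
    (N : W -> R -> Prop) (A : {fraction R} -> Prop) : W -> Prop :=
  fun d => is_limit lt d /\
    exists u, T_delta lt r A d u /\
      forall f : R, f \is a GRing.unit ->
        exists s, lt s d /\
          ~ (exists n x, N d n /\ A x /\ (u s * f)%:F = n%:F + (r s)%:F * x).

(* Main.v *)
From HB Require Import structures.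
Require Import Defs.
From mathcomp Require Import all_boot all_order all_algebra fraction generic_quotient.
From mathcomp Require Import boolp functions ring.
Import GRing.Theory.
Local Open Scope ring_scope.

(* Write I_s for the ideal of those x in R with x / r_s in A; the I_s decrease.
   A "coherent system" is a family of units e_s^t (s <= t) with
   e_s^s = 1 and e_t^u e_s^t = e_s^u mod I_s; it makes the modules R / I_s into a
   direct system with maps 1 |-> (r_t / r_s) e_s^t, whose limit is uniserial of
   type J / A.  An isomorphism of the limit with some J' / A' yields units g_s
   with g_t e_s^t = g_s mod I_s.
   The system is built by recursion on t.  Since t is countable, the rows below t
   are always trivialised by some units c_s, and these can be found in N_t when
   all earlier entries lie in N_t.  If moreover t is in E', witnessed by u, put
   e_s^t := c_s u_s.  Given trivialising g, a cub of t has g_s and all earlier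
   entries in N_t, so for such a t in E' one gets
   u_s g_t = g_s / c_s in N_t + I_s for all s < t, against the choice of u. *)

(** * Combinatorics of omega_1 *)

Section Omega1.
Variables (W : Type) (lt : W -> W -> Prop).
Hypothesis W1 : is_omega1 lt.

Let irr x : ~ lt x x. Proof. by case: W1 => -[h _] _ _ _ _; exact: h. Qed.
Let tr y x z : lt x y -> lt y z -> lt x z.
Proof. by case: W1 => -[_ h] _ _ _ _; exact: h. Qed.
Let tot x y : lt x y \/ x = y \/ lt y x.
Proof. by case: W1 => _ h _ _ _; exact: h. Qed.
Let wf : well_founded lt. Proof. by case: W1. Qed.

Lemma wf_min (P : W -> Prop) :
  (exists w, P w) -> exists w, P w /\ forall v, lt v w -> ~ P v.
Proof.
case=> w; elim/(well_founded_ind wf): w => w IH Pw.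
have [[v [vw Pv]]|h] := lem (exists v, lt v w /\ P v); first exact: (IH v).
by exists w; split=> // v vw Pv; apply: h; exists v.
Qed.

(** Strict initial segments are countable; taking the successor of their codes frees 0 for [w]
    itself. One choice fixes [h w] for all [w]. *)
Lemma omega1_code : exists h : W -> W -> nat, forall w x y,
  (lt x w \/ x = w) -> (lt y w \/ y = w) -> h w x = h w y -> x = y.
Proof.
suff /choice[h hP] : forall w, exists h : W -> nat, forall x y,
    (lt x w \/ x = w) -> (lt y w \/ y = w) -> h x = h y -> x = y by exists h.
move=> w; have [_ _ _ _ /(_ w)[f finj]] := W1.
exists (fun x => if pselect (lt x w) is left p then (f (exist _ x p)).+1 else 0%N).
move=> x y xw yw; case: pselect => [p|np]; case: pselect => [q|nq] //.
  by case=> /finj [].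
by case: xw => // ->; case: yw => // ->.
Qed.

(** If [g] were unbounded, every [b] would lie at or below some [g n], and [n] together with the
    code of [b] relative to [g n] would inject [W] into [nat]. *)
Lemma omega1_bounded (g : nat -> W) : exists b, forall n, lt (g n) b.
Proof.
apply: contrapT => nb; have [h hinj] := omega1_code.
have /choice[n nP] : forall b, exists n, lt b (g n) \/ b = g n.
  move=> b; apply: contrapT => h0; apply: nb; exists b => n.
  by have [//|[e|l]] := tot (g n) b; exfalso; apply: h0; exists n; [right|left].
have [_ _ _ hW _] := W1; apply: hW.
exists (fun b => pickle (n b, h (g (n b)) b)) => x y /(pcan_inj pickleK)[e1].
by rewrite -e1 => /hinj; apply; [|rewrite e1]; exact: nP.
Qed.

Lemma omega1_gt2 a b : exists c, lt a c /\ lt b c.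
Proof.
have [c cP] := omega1_bounded (fun n => if n is 0 then a else b).
by exists c; split; [exact: (cP 0)|exact: (cP 1%N)].
Qed.

Lemma omega1_enum (P : W -> Prop) w :
  (forall x, P x -> lt x w \/ x = w) -> (exists x, P x) ->
  exists s : nat -> W, (forall n, P (s n)) /\ forall x, P x -> exists n, s n = x.
Proof.
move=> Pw [x0 Px0]; have [h hinj] := omega1_code.
have /choice[s sP] : forall n, exists y, P y /\ forall x, P x -> h w x = n -> y = x.
  move=> n; have [[x [Px xn]]|hn] := lem (exists x, P x /\ h w x = n).
    by exists x; split=> // y Py yn; apply: (hinj w); [exact: Pw..|rewrite yn].
  by exists x0; split=> // x Px xn; case: hn; exists x.
exists s; split=> [n|x Px]; first by case: (sP n).
by exists (h w x); case: (sP (h w x)) => _; apply.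
Qed.

(** The sequence is the running maximum of an enumeration of the predecessors. It may become
    constant, since [d] can be a successor. *)
Lemma omega1_cofinal d : (exists s, lt s d) -> exists s : nat -> W,
  [/\ (forall n, lt (s n) d),
      (forall n, lt (s n) (s n.+1) \/ s n = s n.+1) &
      (forall x, lt x d -> exists n, lt x (s n) \/ x = s n)].
Proof.
move=> /(@omega1_enum (lt^~ d) d (fun x h => or_introl h))[g [gd gP]].
pose s := fix s n := if n is m.+1 then
  (if pselect (lt (s m) (g m.+1)) then g m.+1 else s m) else g 0%N.
exists s; split=> [n|n|x /gP[n <-]].
- by elim: n => [|n IH] /=; [|case: (pselect _) => ? //]; exact: gd.
- by rewrite /=; case: (pselect _); [left|right].
- exists n; case: n => [|n]; first by right.
  rewrite /=; case: (pselect _) => [l|h] /=; first by right.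
  by have [//|[e|]] := tot (s n) (g n.+1); [right; rewrite e|left].
Qed.

(** Above [a], iterate a map [nx] that passes [t] and all [H s] with [s] at most [t]; the least
    strict upper bound of the iterates is a closure point. *)
Lemma cub_closure_points (H : W -> W) :
  is_cub lt (fun d => is_limit lt d /\ forall s, lt s d -> lt (H s) d).
Proof.
split=> [a|d dlim dP]; last first.
  split=> // s /dP[g [[_ gP] [sg gd]]].
  by apply: tr gd; exact: gP.
have /choice[nx nxP] : forall t, exists b, lt t b /\
    forall s, (lt s t \/ s = t) -> lt (H s) b.
  move=> t; have [||s [_ sP]] := @omega1_enum (fun s => lt s t \/ s = t) t.
    by [].
    by exists t; right.
  have [b1 b1P] := omega1_bounded (fun n => H (s n)).
  have [b [tb b1b]] := omega1_gt2 t b1.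
  exists b; split=> // x /sP[n <-]; apply: tr b1b; exact: b1P.
pose s n := iter n nx a.
have [d [dP dmin]] := @wf_min (fun d => forall n, lt (s n) d) (omega1_bounded s).
have below x : lt x d -> exists n, lt x (s n).
  move=> xd; apply: contrapT => hx; apply: (dmin x xd) => n.
  have [//|[e|l]] := tot (s n) x; last by case: hx; exists n.
  by case: hx; exists n.+1; rewrite -e; case: (nxP (s n)).
exists d; split; last exact: (dP 0%N).
split.
  split=> [|x /below[n xn]]; first by exists a; exact: (dP 0%N).
  by exists (s n); split.
move=> x /below[n xn]; apply: tr (dP n.+1); case: (nxP (s n)) => _; apply.
by left.
Qed.

(** Recursion with a choice at each stage: [P d e] looks at [e] only below [d], so the choice at [d]
    may presuppose [P] at all earlier stages. *)
Lemma wf_construct (B : Type) (b0 : B) (P : W -> (W -> B) -> B -> Prop) :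
  (forall d e e', (forall t, lt t d -> e t = e' t) ->
     forall c, P d e c -> P d e' c) ->
  (forall d e, (forall t, lt t d -> P t e (e t)) -> exists c, P d e c) ->
  exists e, forall d, P d e (e d).
Proof.
move=> Ploc Pstep.
pose ext d (rec : forall t, lt t d -> B) t :=
  if pselect (lt t d) is left p then rec t p else b0.
(* The default [b0] covers the absence of an admissible [c]; the induction below shows that this
   never occurs. *)
pose F d (rec : forall t, lt t d -> B) :=
  if pselect (exists c, P d (ext d rec) c) is left p then projT1 (cid p) else b0.
pose e := Fix wf (fun=> B) F.
have eE d : e d = F d (fun t _ => e t).
  rewrite /e Fix_eq // => x f g fg; congr F.
  by apply: functional_extensionality_dep => y;
     apply: functional_extensionality_dep => p.
have extE d t : lt t d -> ext d (fun t _ => e t) t = e t.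
  by move=> td; rewrite /ext; case: pselect.
exists e; elim/(well_founded_ind wf) => d IH.
rewrite eE /F; case: pselect => [p|[]].
  by case: cid => c /= cP; apply: Ploc cP => t /extE.
apply: Pstep => t td; rewrite extE //.
apply: Ploc (IH t td) => u ut; rewrite extE //; exact: tr td.
Qed.

End Omega1.

(** * Modules and fractions *)

Lemma submoduleB (R : idomainType) (M : lmodType R) (P : M -> Prop) :
  submodule P -> forall x y, P x -> P y -> P (x - y).
Proof. by case=> _ D Z x y Px Py; apply: D => //; rewrite -scaleN1r; exact: Z. Qed.

(** The quotient is carried by canonical representatives, and [p] sends an element of [S] to its
    representative; outside [S] its value is a default. *)
Lemma subquotient_lmod (R : idomainType) (V : lmodType R) (S Z : V -> Prop) :
  submodule S -> submodule Z ->
  exists (M : lmodType R) (p : V -> M),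
    [/\ (forall x y, S x -> S y -> p (x + y) = p x + p y),
        (forall (c : R) x, S x -> p (c *: x) = c *: p x),
        (forall m, exists x, S x /\ p x = m) &
        (forall x, S x -> (p x = 0 <-> Z x))].
Proof.
move=> Ssub Zsub; have [S0 SD SZ] := Ssub; have [Z0 ZD ZZ] := Zsub.
have ZB := submoduleB _ _ _ Zsub; have SB := submoduleB _ _ _ Ssub.
have ZN x : Z x -> Z (- x) by rewrite -sub0r; exact: ZB.
pose near x y := S y /\ Z (y - x).
pose rep x := if pselect (exists y, near x y) is left h then projT1 (cid h) else 0.
(* [rep x] depends on [x] only through the predicate [near x], so congruent elements get equal
   representatives. *)
have rep_eq x y : Z (x - y) -> rep x = rep y.
  move=> xy; rewrite /rep; suff -> : near x = near y by [].
  apply/funext => z; apply/propext; split=> -[Sz zz]; split=> //.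
    by have := ZD _ _ zz xy; rewrite addrA subrK.
  by have := ZB _ _ zz xy; rewrite opprB addrA subrK.
have repP x : S x -> S (rep x) /\ Z (rep x - x).
  move=> Sx; rewrite /rep; case: pselect => [h|[]]; first by case: cid => y [].
  by exists x; split=> //; rewrite subrr.
pose T := {y | S y /\ rep y = y}.
have repT x : S x -> S (rep x) /\ rep (rep x) = rep x.
  by move=> /repP[Sr Zr]; split=> //; exact: rep_eq.
pose p x : T := if pselect (S x) is left h then exist _ (rep x) (repT x h)
  else exist _ (rep 0) (repT 0 S0).
have ST (a : T) : S (sval a) by case: (svalP a).
have pP x : S x -> Z (sval (p x) - x).
  by move=> Sx; rewrite /p; case: pselect => // h; case: (repP x Sx).
have TP (a b : T) : Z (sval a - sval b) -> a = b.
  move=> /rep_eq; case: a b => a ha [b hb] /= e; apply: eq_exist => /=.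
  by rewrite -(proj2 ha) e (proj2 hb).
have pE x (a : T) : S x -> Z (x - sval a) -> p x = a.
  by move=> Sx h; apply: TP; have := ZD _ _ (pP x Sx) h; rewrite addrA subrK.
have pK (a : T) : p (sval a) = a by apply: pE; rewrite ?subrr.
have p_eq x y : S x -> S y -> Z (x - y) -> p x = p y.
  move=> Sx Sy h; apply: pE => //; have := ZB _ _ h (pP y Sy).
  by rewrite opprB addrA subrK.
pose add (a b : T) : T := p (sval a + sval b).
pose opp (a : T) : T := p (- sval a).
pose scale (c : R) (a : T) : T := p (c *: sval a).
have SN x : S x -> S (- x) by move=> Sx; rewrite -sub0r; exact: SB.
have pD x y : S x -> S y -> p (x + y) = add (p x) (p y).
  move=> Sx Sy; apply/esym/p_eq; [exact: SD..|].
  by have := ZD _ _ (pP x Sx) (pP y Sy); rewrite addrACA -opprD.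
have pZ c x : S x -> p (c *: x) = scale c (p x).
  by move=> Sx; apply/esym/p_eq; [exact: SZ..|rewrite -scalerBr; apply/ZZ/pP].
have pN x : S x -> p (- x) = opp (p x).
  move=> Sx; apply/esym/p_eq; [exact: SN..|].
  by have := ZN _ (pP x Sx); rewrite opprB addrC opprK.
have sur (a : T) : exists x, S x /\ p x = a by exists (sval a).
have addA : associative add.
  move=> a b c; case: (sur a) (sur b) (sur c) => x [Sx <-] [y [Sy <-]] [z [Sz <-]].
  by rewrite -!pD ?addrA //; exact: SD.
have addC : commutative add by move=> a b; rewrite /add addrC.
have add0 : left_id (p 0) add.
  by move=> a; case: (sur a) => x [Sx <-]; rewrite -pD // add0r.
have addN : left_inverse (p 0) opp add.
  move=> a; case: (sur a) => x [Sx <-].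
  by rewrite -pN // -pD ?addNr //; exact: SN.
pose T1 : choiceType := HB.pack T (gen_eqMixin T) (gen_choiceMixin T).
pose T2 : zmodType := HB.pack T1 (GRing.isZmodule.Build T1 addA addC add0 addN).
have scA c d (a : T) : scale c (scale d a) = scale (c * d) a.
  by case: (sur a) => x [Sx <-]; rewrite -!pZ ?scalerA //; exact: SZ.
have sc1 (a : T) : scale 1 a = a.
  by case: (sur a) => x [Sx <-]; rewrite -pZ // scale1r.
have scDr c (a b : T) : scale c (add a b) = add (scale c a) (scale c b).
  case: (sur a) (sur b) => x [Sx <-] [y [Sy <-]].
  by rewrite -pD // -!pZ ?scalerDr ?pD //; [exact: SZ..|exact: SD].
have scDl (a : T) c d : scale (c + d) a = add (scale c a) (scale d a).
  by case: (sur a) => x [Sx <-]; rewrite -!pZ // scalerDl pD //; exact: SZ.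
pose M : lmodType R :=
  HB.pack T2 (GRing.Zmodule_isLmodule.Build R T2 scA sc1 scDr scDl).
exists M, p; split=> // x Sx; split=> [px0|Zx].
  have : Z (sval (p x) - x) by exact: pP.
  rewrite [p x]px0 => h; have := ZB _ _ (pP 0 S0) h.
  by rewrite opprB addrC subr0 subrK.
by apply: p_eq => //; rewrite subr0.
Qed.

Lemma fraction_ratio (R : idomainType) (x : {fraction R}) :
  exists n d : R, d != 0 /\ x = n%:F / d%:F.
Proof.
elim/quotW: x => x; have d0 := denom_ratioP x.
exists (frac x).1, (frac x).2; split=> //.
have dF : (frac x).2%:F != 0 by rewrite tofrac_eq0.
apply: (mulIf dF); rewrite divfK // -[LHS]/(FracField.mul _ _) !piE.
apply/eqP; rewrite piE FracField.equivfE /FracField.mulf.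
by rewrite !numden_Ratio ?mulr1 ?oner_neq0 // mulrC.
Qed.

(** * Coherent systems of units *)

Section CoherentSystems.
Variables (R : idomainType) (W : Type) (lt : W -> W -> Prop).
Variables (r : W -> R) (A : {fraction R} -> Prop) (N : W -> R -> Prop).
Hypothesis W1 : is_omega1 lt.
Hypothesis r0 : forall nu, r nu != 0.
Hypothesis Asub : submodQ A.

Let irr x : ~ lt x x. Proof. by case: W1 => -[h _] _ _ _ _; exact: h. Qed.
Let tr y x z : lt x y -> lt y z -> lt x z.
Proof. by case: W1 => -[_ h] _ _ _ _; exact: h. Qed.
Let tot x y : lt x y \/ x = y \/ lt y x.
Proof. by case: W1 => _ h _ _ _; exact: h. Qed.
Local Notation le x y := (lt x y \/ x = y).
Let le_tr y x z : le x y -> le y z -> le x z.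
Proof. by move=> [xy|->] // [yz|<-]; left=> //; exact: tr yz. Qed.
Let le_lt_tr y x z : le x y -> lt y z -> lt x z.
Proof. by move=> [|->] //; exact: tr. Qed.

(* The ideal [I_s]: the trace on [R] of [r s * A]. *)
Definition resid (s : W) (x : R) : Prop := A (x%:F / (r s)%:F).
Local Notation I := resid.

Lemma rF_neq0 s : (r s)%:F != 0. Proof. by rewrite tofrac_eq0. Qed.

Lemma residP s x : I s x <-> exists y, A y /\ x%:F = (r s)%:F * y.
Proof.
split=> [Isx|[y [Ay e]]]; last by rewrite /I e mulrC mulKf ?rF_neq0.
by exists (x%:F / (r s)%:F); split=> //; rewrite mulrC divfK ?rF_neq0.
Qed.

Lemma resid0 s : I s 0.
Proof. by case: Asub => h _ _; rewrite /I tofrac0 mul0r. Qed.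
Lemma residD s x y : I s x -> I s y -> I s (x + y).
Proof. by case: Asub => _ h _; rewrite /I tofracD mulrDl; exact: h. Qed.
Lemma residM s c x : I s x -> I s (c * x).
Proof. by case: Asub => _ _ h; rewrite /I tofracM -mulrA; exact: h. Qed.
Lemma residC s x y : I s (x - y) -> I s (y - x).
Proof. by move=> h; rewrite -opprB -mulN1r; exact: residM. Qed.
Lemma resid_trans s y x z : I s (x - y) -> I s (y - z) -> I s (x - z).
Proof. by move=> h1 h2; have := residD _ _ _ h1 h2; rewrite addrA subrK. Qed.
Lemma resid_unit s u x : u \is a GRing.unit -> I s (u * x) -> I s x.
Proof. by move=> uu /(residM s u^-1); rewrite mulKr. Qed.
Lemma resid_all s : I s 1 -> forall x, I s x.
Proof. by move=> h x; rewrite -[x]mulr1; exact: residM. Qed.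

(** Here [k x / r t = x / r s]. Hence multiplication by [k] induces an injection of R / I_s into R /
    I_t. *)
Lemma resid_mul_r s t k x : r t = k * r s -> I t (k * x) <-> I s x.
Proof.
move=> e; have ks : k%:F != 0.
  by rewrite tofrac_eq0; apply: contraTneq (r0 t) => k0; rewrite e k0 mul0r eqxx.
by rewrite /I e !tofracM -mulf_div divff ?mul1r.
Qed.

(* [e t s] stands for [e_s^t]. *)
Definition coherent_row (d : W) (e : W -> W -> R) (c : W -> R) : Prop :=
  (forall s, lt s d -> c s \is a GRing.unit) /\
  (forall s t, le s t -> lt t d -> I s (c t * e t s - c s)).

Definition coherent_system (e : W -> W -> R) (t : W) : Prop :=
  e t t = 1 /\ coherent_row t e (e t).

(** Along s_0, s_1, ... cofinal in [d], put c_x = D_n e_x^(s_n) for some n with x <= s_n; modulo I_x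
    the choice of n does not matter. Only products and inverses of earlier entries occur, and [N d]
    contains the inverses of those of its elements that are units of R. *)
Lemma coherent_row_exists (d : W) (e : W -> W -> R) :
  filtration lt r N -> (forall t, lt t d -> coherent_system e t) ->
  exists c, coherent_row d e c /\
    ((forall s t, lt s t -> lt t d -> N d (e t s)) -> forall s, lt s d -> N d (c s)).
Proof.
move=> [[_ /(_ d)[_ Nd1 _ NdM]] _ _ /(_ d) Nunit _] coh.
have [dne|dempty] := lem (exists s, lt s d); last first.
  by exists (fun=> 1); split=> [|_ s sd]; [split=> s|]; [move=> sd|move=> t _ sd|];
    case: dempty; [exists s|exists t|exists s].
have [s [sd sinc scof]] := omega1_cofinal _ _ W1 d dne.
have /choice[nu nuP] : forall x, exists n, lt x d -> le x (s n).
  move=> x; have [xd|xd] := lem (lt x d); last by exists 0%N.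
  by have [n nP] := scof x xd; exists n.
(* D n inverts the composite e_(s_0)^(s_1) ... e_(s_(n-1))^(s_n). *)
pose D := fix D n := if n is m.+1 then D m / e (s m.+1) (s m) else 1.
have unitE x n : le x (s n) -> e (s n) x \is a GRing.unit.
  have [e1 [eu _]] := coh _ (sd n).
  by move=> [|->]; [exact: eu|rewrite e1 unitr1].
have Du n : D n \is a GRing.unit.
  by elim: n => [|n IH] /=; rewrite ?unitr1 // unitrM IH unitrV unitE.
have cohE x y n : le x y -> le y (s n) -> I x (e (s n) y * e y x - e (s n) x).
  have [e1 [_ ec]] := coh _ (sd n).
  move=> xy [yn|yn]; first exact: ec.
  by rewrite yn e1 mul1r subrr; exact: resid0.
have step x n : le x (s n) -> I x (D n.+1 * e (s n.+1) x - D n * e (s n) x).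
  move=> xn; have uE := unitE _ _ (sinc n).
  have -> : D n = D n.+1 * e (s n.+1) (s n) by rewrite /= mulrVK.
  move: (D n.+1) => v; rewrite -!mulrA -mulrBr.
  by apply: residM; apply: residC; apply: cohE.
have les x n k : le x (s n) -> le x (s (n + k)%N).
  elim: k => [|k IH] xn; first by rewrite addn0.
  by rewrite addnS; apply: le_tr (sinc _); exact: IH.
have steps x n k : le x (s n) -> I x (D (n + k)%N * e (s (n + k)%N) x - D n * e (s n) x).
  move=> xn; elim: k => [|k IH]; first by rewrite addn0 subrr; exact: resid0.
  by rewrite addnS; apply: resid_trans IH; apply: step; exact: les.
have cmp x n m : le x (s n) -> le x (s m) ->
    I x (D m * e (s m) x - D n * e (s n) x).
  move=> xn xm; have [nm|/ltnW mn] := leqP n m.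
    by rewrite -(subnKC nm); exact: steps.
  by apply: residC; rewrite -(subnKC mn); exact: steps.
exists (fun x => D (nu x) * e (s (nu x)) x); split; first split.
- by move=> x xd; rewrite unitrM Du unitE //; exact: nuP.
- move=> x y xy yd; have xd := le_lt_tr _ _ _ xy yd.
  have yn := nuP y yd; have xn := nuP x xd.
  apply: (resid_trans _ (D (nu y) * e (s (nu y)) x)); last first.
    by apply: cmp => //; exact: le_tr yn.
  by rewrite -mulrA -mulrBr; apply: residM; apply: cohE.
- move=> NE; have NE' x n : le x (s n) -> N d (e (s n) x).
    move=> [xn|->]; first exact: NE.
    by have [-> _] := coh _ (sd n).
  have NV x : x \is a GRing.unit -> N d x -> N d x^-1.
    move=> xu Nx; have [/(_ xu)[y [Ny xy]] _] := Nunit x Nx.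
    by rewrite -[x^-1]mulr1 -xy mulKr.
  have ND n : N d (D n).
    elim: n => [|n IH] //=; apply: NdM => //; apply: NV; [exact: unitE|exact: NE'].
  by move=> x xd; apply: NdM => //; apply: NE'; exact: nuP.
Qed.

(** * Diagonalising against the filtration *)

Definition avoids (d : W) (c : W -> R) : Prop :=
  forall f : R, f \is a GRing.unit ->
    exists s, lt s d /\ forall n, N d n -> ~ I s (c s * f - n).

Lemma E'_setP d : E'_set lt r N A d -> exists u,
  [/\ forall s, lt s d -> u s \is a GRing.unit,
      forall s t, lt s t -> lt t d -> I s (u t - u s) & avoids d u].
Proof.
move=> [_ [u [[uu uc] uf]]]; exists u; split=> // [s t st td|f /uf[s [sd sP]]].
  by apply/residP; exact: uc.
exists s; split=> // n Nn /residP[y [Ay e]]; apply: sP; exists n, y.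
by split=> //; split=> //; rewrite -e tofracB addrC subrK.
Qed.

(** Avoidance is obtained from trivialising units lying in [N d], hence the first premise; it holds
    for all [d] in some cub. *)
Definition diagonal (e : W -> W -> R) (d : W) (c : W -> R) : Prop :=
  (forall s t, lt s t -> lt t d -> N d (e t s)) -> E'_set lt r N A d -> avoids d c.

Lemma coherent_system_exists : filtration lt r N ->
  exists e, forall d, coherent_system e d /\ diagonal e d (e d).
Proof.
move=> fil; have [[_ Nring] _ _ Nunit _] := fil.
pose P d e c := (c d = 1 /\ coherent_row d e c) /\ diagonal e d c.
apply: (wf_construct _ _ W1 _ (fun=> 1) P).
  move=> d e e' ee' c [[c1 [cu cc]] cd]; split; first split=> //; first split=> //.
    by move=> s t st td; rewrite -ee' //; exact: cc.
  move=> NE; apply: cd => s t st td; rewrite ee' //; exact: NE.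
move=> d e eP; have [c [[cu cc] cN]] := coherent_row_exists _ _ fil
  (fun t td => proj1 (eP t td)).
have [u [uu uc uE]] : exists u, [/\ forall s, lt s d -> u s \is a GRing.unit,
    forall s t, lt s t -> lt t d -> I s (u t - u s) &
    E'_set lt r N A d -> avoids d u].
  have [/E'_setP[u [uu uc uf]]|h] := lem (E'_set lt r N A d); first by exists u.
  by exists (fun=> 1); split=> // [s _|s t _ _]; rewrite ?unitr1 // subrr; exact: resid0.
exists (fun s => if pselect (s = d) then 1 else c s * u s).
have cE s : lt s d -> (if pselect (s = d) then 1 else c s * u s) = c s * u s.
  by move=> sd; case: (pselect _) => // e0; case: (irr d); rewrite -{1}e0.
split; first split; first by case: (pselect _).
  split=> [s sd|s t st td]; first by rewrite cE // unitrM cu ?uu.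
  have sd := le_lt_tr _ _ _ st td; rewrite !cE //.
  (* The coherence of [c] handles the first difference, that of [u] the second. *)
  apply: (resid_trans _ (u t * c s)).
    by rewrite mulrAC [X in X - _]mulrC -mulrBr; apply: residM; apply: cc.
  rewrite mulrC -mulrBr; apply: residM.
  by case: st => [|->]; [move/uc; exact|rewrite subrr; exact: resid0].
move=> NE dE f fu; have [s [sd sP]] := uE dE f fu.
(* If c_s u_s f were in n + I_s, then u_s f would be in c_s^-1 n + I_s, where c_s^-1 n is in [N d]
   because c_s is a unit of [N d]. *)
exists s; split=> // n Nn; rewrite cE //; apply: contra_not (sP ((c s)^-1 * n) _).
  move=> h; apply: (resid_unit _ (c s)); first exact: cu.
  by rewrite mulrBr mulrA mulVKr ?cu.
have [_ _ _ NM] := Nring d; apply: NM => //.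
have [/(_ (cu s sd))[y [Ny xy]] _] := Nunit _ _ (cN NE s sd).
by rewrite -[_^-1]mulr1 -xy mulKr ?cu.
Qed.

(** * The direct limit of a coherent system *)

(* The limit is realised as sequences that eventually agree with a multiple of some
   [b s := (k s t * e t s)_t], modulo those with eventually [x t] in [I_t]. *)
Lemma limit_module (e k : W -> W -> R) :
  (forall d, coherent_system e d) ->
  (forall s t, le s t -> r t = k s t * r s) ->
  exists (M : lmodType R) (b : W -> M),
    [/\ forall s t, le s t -> b s = (k s t * e t s) *: b t,
        forall s a, a *: b s = 0 <-> I s a &
        forall m, exists s a, m = a *: b s].
Proof.
move=> coh kE.
have kM s t u : le s t -> le t u -> k s u = k s t * k t u.
  move=> st tu; apply: (mulIf (r0 s)); rewrite -kE; last exact: le_tr tu.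
  by rewrite (kE t u) // (kE s t) // mulrA [k t u * _]mulrC.
pose V : lmodType R := (W -> R^o : lmodType R).
pose b s : V := fun t => k s t * e t s.
pose Z (x : V) := exists p, forall t, lt p t -> I t (x t).
pose S (x : V) := exists s a, Z (x - a *: b s).
have Zsub : submodule Z.
  have [s0 _] : exists s : W, True.
    apply: contrapT => h; case: W1 => _ _ _ hW _; apply: hW.
    by exists (fun=> 0%N) => x; case: h; exists x.
  split=> [|x y [p px] [q qy]|c x [p px]].
  - by exists s0 => t _; exact: resid0.
  - have [u [pu qu]] := omega1_gt2 _ _ W1 p q.
    by exists u => t ut; apply: residD; [apply: px; exact: tr ut|apply: qy; exact: tr ut].
  - by exists p => t pt; apply: residM; exact: px.
have [Z0 ZD ZZ] := Zsub; have ZB := submoduleB _ _ _ Zsub.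
have bq s t : le s t -> Z (b s - (k s t * e t s) *: b t).
  move=> st; exists t => u tu; have su := le_lt_tr _ _ _ st tu.
  have [_ [_ ec]] := coh u.
  rewrite /b !fctE /= -[_ *: _]/(_ * _) (kM s t u) //; last by left.
  (* The coordinate at [u] is [k s u] times a coherence defect in I_s, hence lies in I_u. *)
  rewrite [X in I _ X](_ : _ = k s t * k t u * (e u s - e u t * e t s)); last by ring.
  rewrite -(kM s t u) //; last by left.
  apply/(resid_mul_r s u); first by apply: kE; left.
  by apply: residC; exact: ec.
have Sup x s t a : le s t -> Z (x - a *: b s) -> exists a', Z (x - a' *: b t).
  move=> st h; exists (a * (k s t * e t s)).
  have := ZD _ _ h (ZZ a _ (bq s t st)).
  by rewrite scalerBr addrA subrK scalerA.
have Ssub : submodule S.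
  split=> [|x y [s [a xs]] [t [c yt]]|c x [s [a xs]]].
  - have [p _] := Z0; exists p, 0.
    by rewrite scale0r subr0.
  - have [u [su tu]] := omega1_gt2 _ _ W1 s t.
    have [a' xu] := Sup _ _ _ _ (or_introl su) xs.
    have [c' yu] := Sup _ _ _ _ (or_introl tu) yt.
    exists u, (a' + c'); have := ZD _ _ xu yu.
    by rewrite addrACA -opprD -scalerDl.
  - by exists s, (c * a); have := ZZ c _ xs; rewrite scalerBr scalerA.
have [M [p [pD pZ psur pker]]] := subquotient_lmod R V S Z Ssub Zsub.
have [S0 SD SZ] := Ssub.
have Sb s : S (b s) by exists s, 1; rewrite scale1r subrr.
have peq x y : S x -> S y -> Z (x - y) -> p x = p y.
  move=> Sx Sy /(pker _ (submoduleB _ _ _ Ssub _ _ Sx Sy)) h.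
  apply/eqP; rewrite -subr_eq0 -scaleN1r -pZ // -pD //; last exact: SZ.
  by rewrite scaleN1r h.
exists M, (fun s => p (b s)); split=> [s t st|s a|m].
- by rewrite -pZ //; apply: peq; [|exact: SZ|exact: bq].
- rewrite -pZ // pker; last exact: SZ.
  split=> [[q qP]|Isa].
    (* A single coordinate beyond [s] and [q] decides: cancelling [k s u] and the unit [e u s]
       leaves [a] in I_s. *)
    have [u [su qu]] := omega1_gt2 _ _ W1 s q.
    have [_ [eu _]] := coh u.
    apply: (resid_unit _ (e u s)); first exact: eu.
    apply/(resid_mul_r s u (k s u)); first by apply: kE; left.
    have := qP u qu; rewrite /b !fctE /= -[_ *: _]/(_ * _).
    by rewrite mulrC -mulrA.
  exists s => t st; rewrite /b !fctE /= -[_ *: _]/(_ * _) mulrCA.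
  apply/(resid_mul_r s t); first by apply: kE; left.
  by rewrite mulrC; exact: residM.
- have [x [[s [a xs]] <-]] := psur m; exists s, a.
  rewrite -pZ //; apply: peq => //; last exact: SZ.
  by exists s, a.
Qed.

(** * Consequences of the valuation property *)

Hypothesis Rval : valuation_domain R.

(** R is local: one of [x], [y] divides the other, hence divides the sum. *)
Lemma unit_addP (x y : R) :
  x + y \is a GRing.unit -> x \is a GRing.unit \/ y \is a GRing.unit.
Proof.
have [[c ->]|[c ->]] := Rval x y.
  by rewrite -{1}[x]mul1r -mulrDl unitrM => /andP[_ h]; left.
by rewrite -{2}[y]mul1r -mulrDl unitrM => /andP[_ h]; right.
Qed.

Lemma unit_subr (u m : R) :
  u \is a GRing.unit -> m \isn't a GRing.unit -> u - m \is a GRing.unit.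
Proof.
by move=> uu mu; have [||h] := unit_addP (u - m) m; rewrite ?subrK // h in mu *.
Qed.

Lemma fraction_valuation (x y : {fraction R}) :
  (exists c : R, x = c%:F * y) \/ (exists c : R, y = c%:F * x).
Proof.
have [n [d [d0 ->]]] := fraction_ratio _ x; have [m [f [f0 ->]]] := fraction_ratio _ y.
have dF : d%:F != 0 by rewrite tofrac_eq0.
have fF : f%:F != 0 by rewrite tofrac_eq0.
have [[c e]|[c e]] := Rval (n * f) (m * d); [right|left]; exists c; apply/eqP;
  rewrite mulrA -tofracM eqr_div // -!tofracM tofrac_eq; apply/eqP.
  by rewrite e mulrA.
by rewrite -mulrA -e.
Qed.

Lemma comparable_uniserial (M : lmodType R) :
  (forall x y : M, (exists c, x = c *: y) \/ (exists c, y = c *: x)) -> uniserial M.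
Proof.
move=> h P Q [_ _ PZ] [_ _ QZ]; have [PQ|/existsNP[x]] := lem (forall x, P x -> Q x).
  by left.
move=> /not_implyP[Px nQx]; right=> y Qy.
have [[c e]|[c ->]] := h x y; last exact: PZ.
by case: nQx; rewrite e; exact: QZ.
Qed.

(** * Uniseriality, type and standardness of the limit *)

Section Limit.
Variables (e k : W -> W -> R) (M : lmodType R) (b : W -> M).
Hypothesis coh : forall d, coherent_system e d.
Hypothesis kE : forall s t, le s t -> r t = k s t * r s.
Hypothesis bE : forall s t, le s t -> b s = (k s t * e t s) *: b t.
Hypothesis bann : forall s a, a *: b s = 0 <-> I s a.
Hypothesis bsur : forall m, exists s a, m = a *: b s.

Let up s t : exists u, le s u /\ le t u.
Proof.
by have [u [su tu]] := omega1_gt2 _ _ W1 s t; exists u; split; left.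
Qed.

Let unitE s t : le s t -> e t s \is a GRing.unit.
Proof.
by have [e1 [eu _]] := coh t; case=> [|->]; [exact: eu|rewrite e1 unitr1].
Qed.

Let kF_neq0 s t : le s t -> (k s t)%:F != 0.
Proof.
move=> st; rewrite tofrac_eq0; apply: contraTneq (r0 t) => k0.
by rewrite (kE s t) // k0 mul0r eqxx.
Qed.

Let kF s t : le s t -> (k s t)%:F = (r t)%:F / (r s)%:F.
Proof. by move=> st; rewrite (kE s t) // tofracM mulfK ?rF_neq0. Qed.

Lemma limit_uniserial : uniserial M.
Proof.
apply: comparable_uniserial => x y.
have [s [a ->]] := bsur x; have [t [c ->]] := bsur y.
have [u [su tu]] := up s t; rewrite (bE s u) // (bE t u) // !scalerA.
move: (a * _) (c * _) => a' c'.
by have [[d ->]|[d ->]] := Rval a' c'; [right|left]; exists d; rewrite scalerA.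
Qed.

(** Multiplication by [r s0] carries J onto D(b_s0) and A onto Ann(b_s0). The assumption on [s0]
    makes b_s0 nonzero and forces r_s0 A into R. *)
Lemma limit_type s0 : ~ I s0 1 -> has_type M (Jset r) A.
Proof.
move=> s01; exists (b s0); split.
  by apply/eqP => b0; apply: s01; apply/bann; rewrite scale1r.
have [_ _ AZ] := Asub.
exists (fun x => (r s0)%:F * x); split.
- by move=> x y _ _; rewrite mulrDr.
- by move=> c x _; rewrite mulrCA.
(* The denominator is [k s0 u], which divides b_s0; the numerator comes from
   [r s0 / r t = k t u / k s0 u]. *)
- move=> x [t [s ->]]; have [u [tu su]] := up t s0.
  exists (k s0 u); split; first by rewrite -tofrac_eq0 kF_neq0.
    by exists (e u s0 *: b u); rewrite scalerA -bE.
  exists (s * k t u); rewrite tofracM !kF //.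
  (* [field] does not terminate on [{fraction R}], whose operations it unfolds. *)
  have field_id (F : fieldType) (z p t' u' : F) : p != 0 -> t' != 0 -> u' != 0 ->
      p * (z / t') = z * (u' / t') / (u' / p).
    by move=> ? ? ?; field; apply/and3P.
  by apply: field_id; exact: rF_neq0.
- move=> y [c [c0 [m bm] [s ->]]]; have [t [a mE]] := bsur m.
  have [u [tu su]] := up t s0.
  (* With [k s0 u = d * c], the element [s / c] is the image of [s d / r u]. *)
  suff [d kd] : divides c (k s0 u).
    exists (s%:F * d%:F / (r u)%:F); split.
      by exists u, (s * d); rewrite tofracM.
    exists 0; rewrite scale0r tofrac0; split=> //.
    have cF : c%:F != 0 by rewrite tofrac_eq0.
    have dF : d%:F != 0.
      by have := kF_neq0 _ _ su; rewrite kd tofracM mulf_eq0 => /norP[].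
    rewrite (kE s0 u) // kd !tofracM.
    have field_id (F : fieldType) (z p c' d' : F) : p != 0 -> c' != 0 -> d' != 0 ->
        p * (z * d' / (d' * c' * p)) - z / c' = 0.
      by move=> ? ? ?; field; apply/and3P.
    by apply: field_id => //; exact: rF_neq0.
  have [//|[d kd]] := Rval c (k s0 u).
  have [du|du] := boolP (d \is a GRing.unit).
    by exists d^-1; rewrite kd mulKr.
  (* Now [c = d * k s0 u] with [d] a non-unit. Comparing b_s0 = c m with its expression through b_u
     shows that a unit times [k s0 u] kills b_u, which puts 1 in I_s0. *)
  case: s01; apply: (resid_unit _ (e u s0 - d * (a * (k t u * e u t)))).
    by apply: unit_subr; [exact: unitE|rewrite unitrM negb_and du].
  rewrite mulr1; apply/(resid_mul_r s0 u); first exact: kE.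
  apply/bann; rewrite mulrBr mulrA [k s0 u * d]mulrC -kd scalerBl -bE //.
  by rewrite -(scalerA c) -(scalerA a) -bE // -mE -bm subrr.
- move=> x _; split=> [[c [/bann Isc xc]]|Ax].
    by move: Isc; rewrite /I -xc mulrC mulKf ?rF_neq0.
  (* If r_s0 x were not in R, then 1 = c r_s0 x for some c in R, and 1 / r_s0 = c x would be in
     A. *)
  have [[c e1]|[c e1]] := fraction_valuation ((r s0)%:F * x) 1.
    exists c; split; last by rewrite e1 mulr1.
    by apply/bann/residP; exists x; split=> //; rewrite e1 mulr1.
  case: s01; rewrite /I tofrac1 e1 [_ * x]mulrC mulrA mulfK ?rF_neq0 //.
  exact: AZ.
Qed.

(** Lift b_s through [f] to y_s in J'. The relation between b_s and b_t becomes a congruence between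
    y_s and y_t modulo A', and the units g_t arise as the ratios of [k s0 t] y_t to y_s0. *)
Lemma limit_standard : standard M -> exists g : W -> R,
  (forall s, g s \is a GRing.unit) /\
  forall s t, lt s t -> I s (g t * e t s - g s).
Proof.
move=> [J' [A' [[_ JD JZ] [_ _ AZ] _ [f [fD fZ fsur fker]]]]].
(* For s below the least s0 with I s0 <> R, all congruences mod I s are void; above it,
   y s is a unit multiple of y s0 * r s0 / r s. *)
have [/(wf_min _ _ W1)[s0 [s01 smin]]|h] := lem (exists s, ~ I s 1); last first.
  exists (fun=> 1); split=> [s|s t _]; first exact: unitr1.
  by apply: resid_all; apply: contrapT => s1; apply: h; exists s.
have fB x y : J' x -> J' y -> f x = f y -> A' (x - y).
  move=> Jx Jy fxy; have JNy : J' (- y).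
    by have := JZ (-1) _ Jy; rewrite tofracN tofrac1 mulN1r.
  apply/fker; first exact: JD.
  by rewrite fD // fxy -[- y]mulN1r -tofrac1 -tofracN fZ // scaleN1r subrr.
have /choice[y yP] : forall s, exists y, J' y /\ f y = b s by move=> s; exact: fsur.
have Jy s : J' (y s) by case: (yP s).
have fy s : f (y s) = b s by case: (yP s).
have ann s a : A' (a%:F * y s) <-> I s a.
  by rewrite -fker ?fZ ?fy ?bann //; exact: JZ.
have ylim s t : le s t -> A' (y s - (k s t * e t s)%:F * y t).
  by move=> st; apply: fB => //; [exact: JZ|rewrite fZ // !fy; exact: bE].
have nA : ~ A' (y s0) by move=> h; apply: s01; apply/ann; rewrite tofrac1 mul1r.
have /choice[g gP] : forall t, exists g : R, g \is a GRing.unit /\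
    (le s0 t -> (k s0 t)%:F * y t = g%:F * y s0).
  move=> t; have [st|st] := lem (le s0 t); last by exists 1; rewrite unitr1.
  (* Since A' contains [d] but not [y s0], one has [d = m * y s0] with [m] a non-unit; so
     [k s0 t * e t s0 * y t] is [1 - m], a unit, times [y s0]. *)
  have Ad := ylim _ _ st; set d := _ - _ in Ad.
  have [m dm] : exists m : R, d = m%:F * y s0.
    have [//|[c yc]] := fraction_valuation d (y s0).
    by case: nA; rewrite yc; exact: AZ.
  have mu : m \isn't a GRing.unit.
    apply/negP => mu; apply: nA; rewrite -[y s0]mul1r -tofrac1 -(mulVr mu) tofracM.
    by rewrite -mulrA -dm; exact: AZ.
  have eu := unitE _ _ st.
  exists ((e t s0)^-1 * (1 - m)); split.
    by rewrite unitrM unitrV eu unit_subr ?unitr1.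
  move=> _; have eF : (e t s0)%:F != 0.
    by rewrite tofrac_eq0; apply: contraTneq eu => ->; rewrite unitr0.
  apply: (mulfI eF); rewrite !mulrA -!tofracM mulVKr // tofracB tofrac1 mulrBl mul1r.
  by rewrite -dm /d opprB addrC subrK [e t s0 * _]mulrC.
exists g; split=> [s|s t st]; first by case: (gP s).
have [ss|s0s] : lt s s0 \/ le s0 s.
  by have [?|[->|?]] := tot s s0; [left|right; right|right; left].
  by apply: resid_all; apply: contrapT => s1; exact: (smin _ ss).
have [gs /(_ s0s) ys] := gP s; have [gt] := gP t.
have s0t := or_introl (le_lt_tr _ _ _ s0s st) : le s0 t.
have st' := or_introl st : le s t.
move=> /(_ s0t) yt; apply/residC/ann.
have -> : (g s - g t * e t s)%:F * y s =
    (g s)%:F * (y s - (k s t * e t s)%:F * y t).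
  rewrite tofracB !tofracM mulrBr mulrBl; congr (_ - _).
  have yE u : le s0 u -> (k s0 u)%:F * y u = (g u)%:F * y s0 ->
      y u = (g u)%:F * y s0 * (r s0)%:F / (r u)%:F.
    move=> su <-; rewrite kF // [_ * y u]mulrC mulrA divfK ?rF_neq0 //.
    by rewrite mulfK ?rF_neq0.
  have field_id (F : fieldType) (p h q z s' t' : F) : s' != 0 -> t' != 0 ->
      p * h * (q * z / s') = q * (t' / s' * h * (p * z / t')).
    by move=> ? ?; field; apply/andP.
  rewrite (yE t) // (yE s) // kF // -!(mulrA _ (y s0)).
  by apply: field_id; exact: rF_neq0.
by apply: AZ; exact: ylim.
Qed.

End Limit.

(** * Impossibility of trivialising a diagonal system *)

Lemma no_trivialising_units (e : W -> W -> R) (g : W -> R) :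
  filtration lt r N -> class_nonzero lt (E'_set lt r N A) ->
  (forall d, coherent_system e d /\ diagonal e d (e d)) ->
  (forall s, g s \is a GRing.unit) ->
  ~ (forall s t, lt s t -> I s (g t * e t s - g s)).
Proof.
move=> [_ [Ninc Ncov] _ _ _] nz eP gu gE.
have /choice[a aP] : forall x, exists a, N a x by [].
have /choice[H HP] : forall t, exists w, N w (g t) /\ forall s, lt s t -> N w (e t s).
  move=> t; have [||s [_ sP]] := omega1_enum _ _ W1 (fun s => le s t) t.
    by [].
    by exists t; right.
  have [w wP] := omega1_bounded _ _ W1 (fun n => a (e t (s n))).
  have [w' [ww' gw']] := omega1_gt2 _ _ W1 w (a (g t)).
  exists w'; split=> [|x /or_introl/sP[n <-]]; first exact: (Ninc _ _ gw').
  by apply: (Ninc _ _ ww'); apply: (Ninc _ _ (wP n)).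
apply: nz; exists (fun d => is_limit lt d /\ forall s, lt s d -> lt (H s) d).
split=> [|d [_ dP] dE]; first exact: cub_closure_points.
have eN s t : lt s t -> lt t d -> N d (e t s).
  by move=> st td; have [_ /(_ s st)] := HP t; apply: (Ninc (H t)); exact: dP.
(* Avoidance is applied to the unit [g d]: its product with [e d s] is congruent modulo I_s to
   [g s], which lies in [N d]. *)
have [_ /(_ eN dE _ (gu d))[s [sd]]] := eP d.
have [/(Ninc _ _ (dP s sd)) Ng _] := HP s; move/(_ _ Ng); apply.
by rewrite mulrC; exact: gE.
Qed.

End CoherentSystems.

Theorem theorem7 (R : idomainType) (W : Type) (lt : W -> W -> Prop)
    (r : W -> R) (A : {fraction R} -> Prop) (N : W -> R -> Prop) :
  is_omega1 lt ->
  valuation_domain R ->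
  not_field_of_fractions R ->
  (exists f : R -> W, (forall x y, f x = f y -> x = y) /\ (forall w, exists x, f x = w)) ->
  (forall nu, r nu != 0) ->
  (forall mu nu, lt mu nu -> divides (r mu) (r nu)) ->
  submodQ A ->
  (forall x, A x -> Jset r x) ->
  filtration lt r N ->
  class_nonzero lt (E'_set lt r N A) ->
  exists M : lmodType R, [/\ uniserial M, ~ standard M & has_type M (Jset r) A].
Proof.
move=> W1 Rval _ _ r0 rdiv Asub _ fil nz.
have [e eP] := coherent_system_exists _ _ _ _ _ _ W1 r0 Asub fil.
have coh d : coherent_system _ _ lt r A e d by case: (eP d).
have /choice[k kP] : forall p : W * W, exists c : R,
    (lt p.1 p.2 \/ p.1 = p.2) -> r p.2 = c * r p.1.
  move=> [s t] /=; have [/rdiv[c rc]|nst] := lem (lt s t); first by exists c.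
  by exists 1 => -[//|->]; rewrite mul1r.
have kE s t : (lt s t \/ s = t) -> r t = k (s, t) * r s by exact: (kP (s, t)).
have [M [b [bE bann bsur]]] :=
  limit_module _ _ _ _ _ W1 r0 Asub e (fun s t => k (s, t)) coh kE.
(* If every I_s were R, no row could avoid [N d], as f = 1 and n = 0 show; then E' would be empty
   and its class zero. *)
have [s0 s01] : exists s, ~ resid _ _ r A s 1.
  apply: contrapT => h; apply: nz; exists (fun d => is_limit lt d /\
    forall s, lt s d -> lt s d); split=> [|d _]; first exact: cub_closure_points.
  case/(E'_setP _ _ _ _ _ _ r0) => u [_ _ /(_ 1 (unitr1 _))[s [_ sP]]].
  have [[_ /(_ d)[Nd0 _ _ _]] _ _ _ _] := fil.
  apply: (sP 0 Nd0); apply: resid_all => //.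
  by apply: contrapT => s1; apply: h; exists s.
exists M; split.
- exact: limit_uniserial bE bsur.
- move=> /(limit_standard _ _ _ _ _ W1 r0 Asub Rval _ _ _ _ coh kE bE bann)[g [gu gE]].
  exact: no_trivialising_units fil nz eP gu gE.
- exact: limit_type coh kE bE bann bsur _ s01.
Qed.
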